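(* Let $k\ge 2$ be an integer, let $c_k := 4\cos^2\frac{\pi}{k+1}$, and let $M=(a_{i,j})$ be a $k\times k$ real matrix. Suppose that there exist $s,l\in\mathbf{Z}$ with $-(k-1)\le s<l\le k-1$ such that $a_{i,j}>0$ whenever $s\le j-i\le l$, and $a_{i,j}=0$ whenever $j-i<s$ or $j-i>l$. If $$a_{i,j}a_{i+1,j+1}\ge c_k\, a_{i,j+1}a_{i+1,j}\qquad (1\le i<k,\ 1\le j<k),$$ then $\det M\ge 0$. *)

(* Defs.v *)
From mathcomp Require Import all_boot all_order all_algebra.
From mathcomp Require Import all_classical all_reals all_analysis.

Set Implicit Arguments.
Unset Strict Implicit.
Unset Printing Implicit Defensive.

Import Order.TTheory GRing.Theory Num.Theory.

Local Open Scope ring_scope.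

Definition cconst (R : realType) (k : nat) : R :=
  4 * cos (pi / k.+1%:R) ^+ 2.

(* Rows and columns are indexed from 0 instead of 1; only the difference
   [j - i], taken in [int], matters. *)
Definition positive_band (R : realType) (k : nat) (s l : int)
    (M : 'M[R]_k) : Prop :=
  forall i j : 'I_k,
    (s <= j%:Z - i%:Z <= l -> 0 < M i j) /\
    (j%:Z - i%:Z < s \/ l < j%:Z - i%:Z -> M i j = 0).

(* Main.v *)
Require Import Defs.
From mathcomp Require Import all_boot all_order all_algebra.
From mathcomp Require Import all_classical all_reals all_analysis.
From mathcomp Require Import zify ring lra.

Set Implicit Arguments.
Unset Strict Implicit.
Unset Printing Implicit Defensive.

Import Order.TTheory GRing.Theory Num.Theory.

Local Open Scope ring_scope.

(** Write [c] for [4 cos^2 (pi/(k+1))], let [A'] be a matrix [A] without its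
    row and column 0, and let [rho_0 = 1], [rho_(n+1) = 1 - 1/(c rho_n)]. The
    [rho_n] are the successive pivots of Gaussian elimination on the tridiagonal
    matrix with unit diagonal and off-diagonal products [1/c], which is the
    extremal case. The choice of [c] is exactly the one for which
    [rho_0, ..., rho_(k-2)] are positive and [rho_(k-1) = 0]: indeed, with
    [theta = pi/(k+1)],
      [rho_n = sin ((n+2) theta) / (2 cos theta sin ((n+1) theta))]
    (lemma [pivot_ratioE]).

    The heart of the proof is the two-sided bound (lemma [sandwich])
      [rho_n a_00 det A' <= det A <= a_00 det A']
    for every matrix [A] of size [n+1] with nonnegative entries such that
      [a_ij a_i'j' >= c^(i'-i) a_ij' a_i'j]  for all [i < i'] and [j < j'].
    This class is chosen because it survives the deletion of row 0 and of any
    column, which is all that the expansion along row 0 requires; the condition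
    on adjacent entries alone would not survive in the presence of zeros, and
    the exponent [i'-i] is the part of the growth that the estimates consume.

    The bound is proved by strong induction on the size. Let [m_j] be the minor
    without row 0 and column [j]. Applying the induction hypothesis repeatedly
    to [m_j] (from below) and to [m_(j+1)] (from above) peels both down to the
    same determinant, at the cost of a factor [rho >= 1/c] per row; the factor
    [c^(j+1)] relating row 0 to row [j+1] pays for it, so that
    [a_0j m_j >= a_0(j+1) m_(j+1)] (lemma [del_col_decreasing]). The expansion
    of [det A] is then an alternating sum of nonincreasing terms, hence lies
    between [a_00 m_0 - a_01 m_1] and [a_00 m_0 = a_00 det A']. One more use of
    the induction hypothesis gives [a_01 m_1 <= a_00 m_0 / (c rho_(n-1))], and
    this is how the recurrence for [rho] arises.

    Finally, a matrix supported on a band belongs to the class: if the corners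
    [a_ij'] and [a_i'j] are nonzero, the whole rectangle between them lies in
    the band, and the adjacent inequalities multiply up across it (lemma
    [dominated_of_adjacent]). *)

(** * Leading minors of infinite matrices *)

Section LeadingMinors.
Variable R : comNzRingType.

(** Matrices are arrays indexed by all of [nat * nat], so that deleting rows and
    columns is plain reindexing, without casts between ordinals. *)
Definition leading_det (n : nat) (a : nat -> nat -> R) : R :=
  \det (\matrix_(i < n, j < n) a i j).

Definition shift (a : nat -> nat -> R) (i j : nat) : R := a i.+1 j.+1.

Definition del_col (h : nat) (a : nat -> nat -> R) (i j : nat) : R :=
  a i (bump h j).

Definition del_row0 (a : nat -> nat -> R) (i j : nat) : R := a i.+1 j.

Lemma eq_leading_det n a b : a =2 b -> leading_det n a = leading_det n b.
Proof.
by move=> eq_ab; congr (\det _); apply/matrixP => i j; rewrite !mxE eq_ab.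
Qed.

Lemma leading_det0 a : leading_det 0 a = 1.
Proof. exact: det_mx00. Qed.

Lemma leading_det_expand n a :
  leading_det n.+1 a =
  \sum_(j < n.+1)
     (-1) ^+ j * (a 0%N j * leading_det n (del_col j (del_row0 a))).
Proof.
rewrite /leading_det (expand_det_row _ ord0); apply: eq_bigr => j _.
rewrite /cofactor mxE mulrCA add0n; congr (_ * (_ * \det _)).
by apply/matrixP => p q; rewrite !mxE.
Qed.

Lemma shift_del_colS h a : shift (del_col h.+1 a) =2 del_col h (shift a).
Proof. by move=> i j; rewrite /shift /del_col bumpS. Qed.

Lemma shift_del_col01 a : shift (del_col 1 a) =2 shift (del_col 0 a).
Proof. by []. Qed.

End LeadingMinors.

(** * Alternating sums *)

Section AlternatingSum.
Variable R : realFieldType.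

Lemma alternating_sum_bounds (n : nat) (w : nat -> R) :
    (forall j, (j <= n)%N -> 0 <= w j) ->
    (forall j, (j.+1 < n)%N -> w j.+1 <= w j) ->
  0 <= \sum_(j < n) (-1) ^+ j * w j <= w 0%N.
Proof.
elim: n w => [|n IHn] w w_ge0 w_dec.
  by rewrite big_ord0 lexx w_ge0.
rewrite big_ord_recl expr0 mul1r.
under eq_bigr => j _ do rewrite lift0 exprS mulN1r mulNr.
rewrite sumrN.
case: n IHn w_ge0 w_dec => [|n] IHn w_ge0 w_dec.
  by rewrite big_ord0 oppr0 addr0 w_ge0 // lexx.
have /andP[S_ge0 S_le] := IHn (w \o S) (fun j => w_ge0 j.+1)
  (fun j => w_dec j.+1).
have w10 := w_dec 0%N isT.
by rewrite /= in S_ge0 S_le; apply/andP; split; lra.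
Qed.

End AlternatingSum.

(** * The two-sided bound *)

Section Sandwich.
Variables (R : realFieldType) (c : R).

(** The factor lost when passing from [a_00 det A'] to [det A] for a matrix of
    size [n.+1]. *)
Fixpoint pivot_ratio (n : nat) : R :=
  if n is m.+1 then 1 - (c * pivot_ratio m)^-1 else 1.

(** The strict positivity up to [n] keeps the recurrence meaningful, since
    [0^-1 = 0]; the last ratio may vanish, as it does for the sharp constant. *)
Definition ratios_ok (n : nat) : Prop :=
  (forall m, (m < n)%N -> 0 < pivot_ratio m) /\ 0 <= pivot_ratio n.

Definition dominated (a : nat -> nat -> R) : Prop :=
  (forall i j, 0 <= a i j) /\
  (forall i i' j j', (i < i')%N -> (j < j')%N ->
     c ^+ (i' - i) * (a i j' * a i' j) <= a i j * a i' j').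

Hypothesis c_gt0 : 0 < c.

Lemma ratios_okW m n : (m <= n)%N -> ratios_ok n -> ratios_ok m.
Proof.
move=> mn [pos nneg]; split=> [p pm|]; first exact/pos/(leq_trans pm).
by move: mn; rewrite leq_eqVlt => /predU1P[->//|/pos/ltW].
Qed.

(** This is where the next ratio being nonnegative is spent: [c] makes up for
    one factor [pivot_ratio n]. *)
Lemma c_pivot_ratio_ge1 n : ratios_ok n.+1 -> 1 <= c * pivot_ratio n.
Proof.
move=> [/(_ n (ltnSn n)) pos]; rewrite /= subr_ge0.
by rewrite invf_le1 // mulr_gt0.
Qed.

Lemma dominated_shift a : dominated a -> dominated (shift a).
Proof.
move=> [a_ge0 a_dom]; split=> [i j|i i' j j' ii' jj']; first exact: a_ge0.
by rewrite -[(i' - i)%N]subSS; apply: a_dom.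
Qed.

Lemma dominated_del_row0 a : dominated a -> dominated (del_row0 a).
Proof.
move=> [a_ge0 a_dom]; split=> [i j|i i' j j' ii' jj']; first exact: a_ge0.
by rewrite -[(i' - i)%N]subSS; apply: a_dom.
Qed.

Lemma dominated_del_col h a : dominated a -> dominated (del_col h a).
Proof.
move=> [a_ge0 a_dom]; split=> [i j|i i' j j' ii' jj']; first exact: a_ge0.
apply: a_dom => //; rewrite /bump; lia.
Qed.

(** The bound is a predicate of the size so that the lemmas below can take it
    as their induction hypothesis. *)
Definition sandwiched (n : nat) : Prop := forall a, dominated a ->
  pivot_ratio n * (a 0%N 0%N * leading_det n (shift a))
    <= leading_det n.+1 a <= a 0%N 0%N * leading_det n (shift a).

Lemma leading_det_ge0 n a :
    (forall m, (m < n)%N -> sandwiched m) ->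
    (forall m, (m < n)%N -> 0 <= pivot_ratio m) ->
  dominated a -> 0 <= leading_det n a.
Proof.
move=> + + aP; elim: n a aP => [|n IHn] a aP sw rP.
  by rewrite leading_det0 ler01.
have /andP[+ _] := sw n (ltnSn n) a aP; apply: le_trans.
rewrite mulr_ge0 ?rP ?mulr_ge0 //; first by case: aP.
by apply: IHn => [|m mn|m mn]; [exact: dominated_shift
  |exact/sw/ltnW|exact/rP/ltnW].
Qed.

(** Deleting column [j] or [j.+1] gives minors whose first [j] pivots sit in
    the same positions and are peeled off one at a time, each step costing a
    factor [pivot_ratio >= c^-1]; the two then differ only in the pivot
    [b j j.+1] against [b j j], and the same minor is left. Keeping the weights
    [x] and [y] arbitrary lets the lower bound's factor be absorbed in [x], so
    that no division occurs and vanishing minors need no special treatment. *)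
Lemma del_col_decreasing n j b x y :
    (forall m, (m < n)%N -> sandwiched m) -> ratios_ok n ->
    dominated b -> (j < n)%N -> 0 <= x -> 0 <= y ->
    c ^+ j.+1 * (y * b j j) <= x * b j j.+1 ->
  y * leading_det n (del_col j.+1 b) <= x * leading_det n (del_col j b).
Proof.
elim: j n b x y => [|j IHj] [|n] // b x y sw rP bP jn x0 y0 xy.
- have rn0 : 0 < pivot_ratio n by case: rP => /(_ n (ltnSn n)).
  have cr1 := c_pivot_ratio_ge1 rP.
  have swn := sw n (ltnSn n).
  have /andP[lo _] := swn _ (dominated_del_col 0 bP).
  have /andP[_ up] := swn _ (dominated_del_col 1 bP).
  move: up lo; rewrite (eq_leading_det n (shift_del_col01 b)).
  set D := leading_det n _; rewrite /del_col [bump 1 0]/= [bump 0 0]/= => up lo.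
  have D0 : 0 <= D.
    apply: leading_det_ge0 => [m mn|m mn|]; [exact/sw/ltnW| |].
      by case: rP => pos _; apply/ltW/pos/ltnW.
    exact/dominated_shift/dominated_del_col.
  have b00 : 0 <= b 0%N 0%N by case: bP.
  apply: (le_trans (ler_wpM2l y0 up)); apply: le_trans (ler_wpM2l x0 lo).
  have h1 : pivot_ratio n * D * (c * (y * b 0%N 0%N)) <=
            pivot_ratio n * D * (x * b 0%N 1%N).
    by rewrite ler_wpM2l // mulr_ge0 // ltW.
  have h2 : 1 * (y * b 0%N 0%N * D) <= c * pivot_ratio n * (y * b 0%N 0%N * D).
    by rewrite ler_wpM2r // !mulr_ge0.
  nra.
have rn0 : 0 < pivot_ratio n by case: rP => /(_ n (ltnSn n)).
have cr1 := c_pivot_ratio_ge1 rP.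
have swn : sandwiched n by exact: sw (ltnSn n).
have /andP[lo _] := swn _ (dominated_del_col j.+1 bP).
have /andP[_ up] := swn _ (dominated_del_col j.+2 bP).
move: lo up; rewrite !(eq_leading_det n (shift_del_colS _ _)).
rewrite /del_col -!/(del_col _ _) ![bump _ 0]/= => lo up.
have b00 : 0 <= b 0%N 0%N by case: bP.
apply: (le_trans (ler_wpM2l y0 up)); apply: le_trans (ler_wpM2l x0 lo).
have xr0 : 0 <= x * pivot_ratio n by rewrite mulr_ge0 // ltW.
have := IHj n (shift b) (x * pivot_ratio n) y.
move=> /(_ (fun m mn => sw m (ltnW mn)) (ratios_okW (leqnSn n) rP)
           (dominated_shift bP) jn xr0 y0).
set A := leading_det _ _; set B := leading_det _ _ => step.
have {step} AB : y * A <= x * pivot_ratio n * B.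
  apply: step; rewrite /shift.
  have z0 : 0 <= c ^+ j.+1 * (y * b j.+1 j.+1).
    by rewrite !mulr_ge0 ?exprn_ge0 ?(ltW c_gt0) //; case: bP.
  have h1 := ler_wpM2r z0 cr1.
  have h2 := ler_wpM2l (ltW rn0) xy.
  move: h2; rewrite [c ^+ j.+2]exprS; nra.
have := ler_wpM2l b00 AB; nra.
Qed.

(** The alternating tail of the expansion along row 0, from index 1 on, is at
    most its first term [a_01 m_1], and [m_1] is compared with [m_0] through the
    minor without rows and columns 0 and 1. *)
Lemma sandwich n : ratios_ok n -> sandwiched n.
Proof.
elim/ltn_ind: n => n IHn rP a aP.
have sw m : (m < n)%N -> sandwiched m.
  by move=> mn; apply: IHn => //; apply: ratios_okW (ltnW mn) rP.
have det_ge0 := leading_det_ge0 sw (fun m mn => ltW (rP.1 m mn)).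
(* [w] is kept opaque: [n] is destructed below, and it occurs in [w]. *)
have [w wE] : exists w, forall j,
    w j = a 0%N j * leading_det n (del_col j (del_row0 a)) by eexists.
have a_ge0 := aP.1.
have w_ge0 j : 0 <= w j.
  rewrite wE mulr_ge0 // det_ge0 //.
  exact/dominated_del_col/dominated_del_row0.
have detE : leading_det n.+1 a = w 0%N - \sum_(j < n) (-1) ^+ j * w j.+1.
  rewrite leading_det_expand big_ord_recl expr0 mul1r -sumrN wE; congr (_ + _).
  by apply: eq_bigr => j _; rewrite lift0 exprS mulN1r mulNr wE.
(* Entries of rows 0 and [j.+1] are compared, whence the exponent [j.+1]. *)
have w_dec j : (j < n)%N -> w j.+1 <= w j.
  move=> jn; rewrite !wE; apply: del_col_decreasing => //.
    exact: dominated_del_row0.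
  by have := aP.2 0%N j.+1 j j.+1 isT (ltnSn j); rewrite subn0.
have /andP[S_ge0 S_le] := @alternating_sum_bounds _ n (w \o S)
  (fun j _ => w_ge0 j.+1) (fun j jn => w_dec j.+1 jn).
rewrite /= in S_ge0 S_le.
have w0E : w 0%N = a 0%N 0%N * leading_det n (shift a) by rewrite wE.
rewrite detE -w0E; apply/andP; split; last by lra.
case: n IHn rP sw det_ge0 wE w_ge0 detE w_dec S_ge0 S_le w0E
  => [|n] IHn rP sw det_ge0 wE w_ge0 detE w_dec S_ge0 S_le w0E.
  by rewrite big_ord0 mul1r subr0.
have swn : sandwiched n by exact: sw (ltnSn n).
have bP := dominated_del_row0 aP.
have /andP[lo _] := swn _ (dominated_del_col 0 bP).
have /andP[_ up] := swn _ (dominated_del_col 1 bP).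
move: up lo; rewrite (eq_leading_det n (shift_del_col01 _)).
set D := leading_det n _.
set m1 := leading_det _ (del_col 1 _); set m0 := leading_det _ _.
rewrite /del_col /del_row0 [bump 1 0]/= [bump 0 0]/= => up lo.
have rn0 : 0 < pivot_ratio n by case: rP => /(_ n (ltnSn n)).
have D0 : 0 <= D.
  apply: leading_det_ge0 => [m mn|m mn|]; [exact/sw/ltnW| |].
    by case: rP => pos _; apply/ltW/pos/ltnW.
  exact/dominated_shift/dominated_del_col.
have cr0 : 0 < c * pivot_ratio n by rewrite mulr_gt0.
(* [a_01 a_10 <= a_00 a_11 / c] links the upper bound on [m_1] with the lower
   bound on [m_0]; multiplying through by [c * pivot_ratio n] avoids dividing by
   the possibly zero common minor [D]. *)
have w1_le : c * pivot_ratio n * w 1%N <= w 0%N.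
  have h1 := ler_wpM2l (a_ge0 0%N 1%N) up.
  have h2 := ler_wpM2l (a_ge0 0%N 0%N) lo.
  have h3 := ler_wpM2l D0 (aP.2 0%N 1%N 0%N 1%N isT isT).
  rewrite subn0 expr1 in h3.
  have h4 := ler_wpM2l (ltW cr0) h1.
  have h5 := ler_wpM2l (ltW rn0) h3.
  rewrite !wE -/m0 -/m1; nra.
rewrite /= mulrBl mul1r lerB //; apply: (le_trans S_le).
by rewrite ler_pdivlMl.
Qed.

Lemma dominated_det_ge0 n a :
  ratios_ok n -> dominated a -> 0 <= leading_det n.+1 a.
Proof.
move=> rP aP; apply: leading_det_ge0 aP => m; rewrite ltnS => mn.
  exact/sandwich/(ratios_okW mn).
by case: (ratios_okW mn rP).
Qed.

(** The cross-ratios of adjacent 2 x 2 blocks multiply over a rectangle, giving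
    the exponent [(i'-i)(j'-j)] and a fortiori [i'-i]. Telescoping cancels the
    intermediate entries, which are positive by the convexity hypothesis unless
    the product [a i j' * a i' j] is zero, and then nothing is to be shown. *)
Lemma dominated_of_adjacent a :
    1 <= c -> (forall i j, 0 <= a i j) ->
    (forall i i' j j' p q, (i <= p <= i')%N -> (j <= q <= j')%N ->
       0 < a i j' -> 0 < a i' j -> 0 < a p q) ->
    (forall i j, c * (a i j.+1 * a i.+1 j) <= a i j * a i.+1 j.+1) ->
  dominated a.
Proof.
move=> c1 a_ge0 a_conv a_adj; split=> //.
have c0 n : 0 <= c ^+ n by rewrite exprn_ge0 // ltW.
have trivial_case i j i' j' n : 0 < a i j' /\ 0 < a i' j \/
    c ^+ n * (a i j' * a i' j) <= a i j * a i' j'.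
  have [->|n1] := eqVneq (a i j') 0.
    by right; rewrite mul0r mulr0 mulr_ge0.
  have [->|n2] := eqVneq (a i' j) 0.
    by right; rewrite !mulr0 mulr_ge0.
  by left; rewrite !lt0r n1 n2 !a_ge0.
have rows d i j : c ^+ d * (a i j.+1 * a (i + d)%N j) <= a i j * a (i + d)%N j.+1.
  elim: d => [|d IHd]; first by rewrite addn0 expr0 mul1r mulrC.
  have [[p1 p2]|//] := trivial_case i j (i + d.+1)%N j.+1 d.+1.
  have q1 : 0 < a (i + d)%N j by apply: (a_conv _ _ _ _ _ _ _ _ p1 p2); lia.
  have q2 : 0 < a (i + d)%N j.+1 by apply: (a_conv _ _ _ _ _ _ _ _ p1 p2); lia.
  have := a_adj (i + d)%N j; rewrite -addnS => adj.
  have l1 : 0 <= c ^+ d * (a i j.+1 * a (i + d)%N j) by rewrite !mulr_ge0.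
  have l2 : 0 <= c * (a (i + d)%N j.+1 * a (i + d.+1)%N j).
    by rewrite !mulr_ge0 // ltW.
  have h := ler_pM l1 l2 IHd adj.
  rewrite -(ler_pM2l (mulr_gt0 q1 q2)) exprS.
  by move: h; congr (_ <= _); ring.
have cols d e i j : c ^+ d * (a i (j + e.+1)%N * a (i + d)%N j)
    <= a i j * a (i + d)%N (j + e.+1)%N.
  elim: e => [|e IHe]; first by rewrite addn1 rows.
  have [[p1 p2]|//] := trivial_case i j (i + d)%N (j + e.+2)%N d.
  have q1 : 0 < a i (j + e.+1)%N by apply: (a_conv _ _ _ _ _ _ _ _ p1 p2); lia.
  have q2 : 0 < a (i + d)%N (j + e.+1)%N.
    by apply: (a_conv _ _ _ _ _ _ _ _ p1 p2); lia.
  have := rows d i (j + e.+1)%N; rewrite -addnS => adj.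
  have cd1 : 1 <= c ^+ d by rewrite exprn_ege1.
  have l1 : 0 <= c ^+ d * (a i (j + e.+1)%N * a (i + d)%N j).
    by rewrite !mulr_ge0.
  have l2 : 0 <= c ^+ d * (a i (j + e.+2)%N * a (i + d)%N (j + e.+1)%N).
    by rewrite !mulr_ge0.
  have h := ler_pM l1 l2 IHe adj.
  rewrite -(ler_pM2l (mulr_gt0 q1 q2)); apply: le_trans (le_trans h _).
    rewrite -subr_ge0; set X := (X in 0 <= X).
    have -> : X = (c ^+ d - 1) * (c ^+ d * (a i (j + e.+1)%N
       * a (i + d)%N (j + e.+1)%N * (a i (j + e.+2)%N * a (i + d)%N j))).
      by rewrite /X; ring.
    by rewrite mulr_ge0 ?subr_ge0 // !mulr_ge0.
  by rewrite le_eqVlt; apply/orP; left; apply/eqP; ring.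
move=> i i' j j' ii' jj'.
have -> : i' = (i + (i' - i))%N by lia.
have -> : j' = (j + (j' - j).-1.+1)%N by lia.
by rewrite addKn.
Qed.

End Sandwich.

(** * The sharp constant *)

Section Trigonometry.
Variables (R : realType) (k : nat).
Hypothesis k_ge2 : (2 <= k)%N.

Let theta : R := pi / k.+1%:R.

Lemma sin_mul_theta_gt0 m : (0 < m < k.+1)%N -> 0 < sin (m%:R * theta).
Proof.
move=> /andP[m0 mk]; apply: sin_gt0_pi.
have pi0 := pi_gt0 R.
rewrite /theta mulrA ltr_pdivrMr ?ltr0n // divr_gt0 ?mulr_gt0 ?ltr0n //=.
by rewrite [ltLHS]mulrC ltr_pM2l // ltr_nat.
Qed.

Lemma cos_theta_gt0 : 0 < cos theta.
Proof.
apply: cos_gt0_pihalf.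
have pi0 := pi_gt0 R.
have t0 : 0 < theta by rewrite divr_gt0 ?ltr0n.
have : theta < pi / 2 by rewrite ltr_pM2l // ltf_pV2 ?posrE ?ltr0n // ltr_nat.
by move=> ->; rewrite andbT; apply: lt_trans t0; rewrite oppr_lt0 divr_gt0.
Qed.

Lemma sin_theta_rec m :
  sin (m.+2%:R * theta) + sin (m%:R * theta)
    = 2 * cos theta * sin (m.+1%:R * theta).
Proof.
have -> : m.+2%:R * theta = m.+1%:R * theta + theta by ring.
have -> : m%:R * theta = m.+1%:R * theta - theta by ring.
rewrite sinD sinB; ring.
Qed.

(** Dividing [sin_theta_rec] by its right-hand side turns the three-term
    recurrence of sines (Chebyshev polynomials of the second kind in
    [cos theta]) into the recurrence of [pivot_ratio], since the constant is
    [(2 cos theta)^2]. *)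
Lemma pivot_ratioE n : (n < k)%N ->
  pivot_ratio (cconst R k) n
    = sin (n.+2%:R * theta) / (2 * cos theta * sin (n.+1%:R * theta)).
Proof.
have ct := lt0r_neq0 cos_theta_gt0.
elim: n => [|n IHn] nk /=.
  have s1 : sin (1%:R * theta) != 0 by rewrite lt0r_neq0 // sin_mul_theta_gt0.
  have := sin_theta_rec 0; rewrite mul0r sin0 addr0 => ->.
  by rewrite divff // !mulf_neq0 // pnatr_eq0.
have s1 : sin (n.+1%:R * theta) != 0.
  by rewrite lt0r_neq0 // sin_mul_theta_gt0 //; lia.
have s2 : sin (n.+2%:R * theta) != 0.
  by rewrite lt0r_neq0 // sin_mul_theta_gt0 //; lia.
rewrite IHn ?(ltnW nk) // /cconst -/theta.
have -> : sin (n.+3%:R * theta)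
    = 2 * cos theta * sin (n.+2%:R * theta) - sin (n.+1%:R * theta).
  by rewrite -sin_theta_rec addrK.
by field; rewrite ct s1 s2.
Qed.

(** All arguments [m theta] with [0 < m <= k] lie in [(0, pi)]; the last ratio
    has numerator [sin ((k+1) theta) = sin pi = 0]. *)
Lemma ratios_ok_cconst : ratios_ok (cconst R k) k.-1.
Proof.
have ct := cos_theta_gt0.
split=> [m mk|]; rewrite pivot_ratioE; try lia.
  by rewrite divr_gt0 ?mulr_gt0 ?sin_mul_theta_gt0 //; lia.
have -> : k.-1.+2%:R * theta = pi.
  by rewrite (_ : k.-1.+2 = k.+1) 1?mulrC ?divfK ?pnatr_eq0 //; lia.
by rewrite sinpi mul0r.
Qed.

Lemma cconst_ge1 : 1 <= cconst R k.
Proof.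
have c0 : 0 < cconst R k by rewrite mulr_gt0 // exprn_gt0 // cos_theta_gt0.
have rP : ratios_ok (cconst R k) 1.
  by apply: ratios_okW ratios_ok_cconst; lia.
by have := c_pivot_ratio_ge1 c0 rP; rewrite mulr1.
Qed.

End Trigonometry.

(** * Band matrices *)

(** Padding with zeros preserves nonnegativity, the adjacent inequalities and
    the convexity of the support, so that no bounds on indices are needed in the
    class of matrices used for the induction. *)
Definition extend0 (R : realFieldType) (k : nat) (M : 'M[R]_k) (i j : nat) : R :=
  if (insub i, insub j) is (Some p, Some q) then M p q else 0.

Lemma extend0E (R : realFieldType) k (M : 'M[R]_k) (i j : 'I_k) :
  extend0 M i j = M i j.
Proof. by rewrite /extend0 !valK. Qed.

Lemma extend0_out (R : realFieldType) k (M : 'M[R]_k) i j :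
  ~~ ((i < k) && (j < k))%N -> extend0 M i j = 0.
Proof.
by rewrite /extend0; case: insubP => [p -> _|//]; case: insubP => [q ->|].
Qed.

Lemma leading_det_extend0 (R : realFieldType) k (M : 'M[R]_k) :
  leading_det k (extend0 M) = \det M.
Proof. by congr (\det _); apply/matrixP => i j; rewrite mxE extend0E. Qed.

Theorem theorem5 (R : realType) (k : nat) (hk : (2 <= k)%N) (M : 'M[R]_k)
    (hband : exists s l : int,
        [/\ - (k%:Z - 1) <= s, s < l, l <= k%:Z - 1 & positive_band s l M])
    (hminor : forall i i' j j' : 'I_k,
        i' = i.+1 :> nat -> j' = j.+1 :> nat ->
        M i j * M i' j' >= cconst R k * (M i j' * M i' j)) :
  0 <= \det M.
Proof.
have [s [l [_ _ _ band]]] := hband.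
have c_ge1 := cconst_ge1 R hk.
rewrite -leading_det_extend0 -[X in leading_det X](ltn_predK hk).
apply: dominated_det_ge0 (ratios_ok_cconst R hk) _.
  exact: lt_le_trans c_ge1.
have inside i j : (i < k)%N -> (j < k)%N ->
    (s <= j%:Z - i%:Z <= l -> 0 < extend0 M i j) /\
    (j%:Z - i%:Z < s \/ l < j%:Z - i%:Z -> extend0 M i j = 0).
  move=> ik jk; have := band (Ordinal ik) (Ordinal jk).
  by rewrite -extend0E.
have gt0P i j : 0 < extend0 M i j -> [/\ (i < k)%N, (j < k)%N &
    s <= j%:Z - i%:Z <= l].
  have [/andP[ik jk]|out] := boolP ((i < k) && (j < k))%N; last first.
    by rewrite extend0_out // ltxx.
  move=> pos; split=> //; have [_ zero] := inside _ _ ik jk.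
  have [//|] := boolP (s <= j%:Z - i%:Z <= l).
  rewrite negb_and -!ltNge => /orP out.
  by move: pos; rewrite zero ?ltxx.
apply: dominated_of_adjacent => //.
- exact: lt_le_trans c_ge1.
- move=> i j; have [/andP[ik jk]|out] := boolP ((i < k) && (j < k))%N; last first.
    by rewrite extend0_out.
  have [pos zero] := inside _ _ ik jk.
  have [/pos/ltW//|] := boolP (s <= j%:Z - i%:Z <= l).
  by rewrite negb_and -!ltNge => /orP/zero->.
- move=> i i' j j' p q ip jq /gt0P[ik j'k b1] /gt0P[i'k jk b2].
  by apply: (inside p q _ _).1; lia.
move=> i j.
have [ik|ik] := ltnP i.+1 k; last first.
  rewrite (@extend0_out _ _ _ i.+1 j) ?(@extend0_out _ _ _ i.+1 j.+1);
    by rewrite ?mulr0 // ltnNge ik.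
have [jk|jk] := ltnP j.+1 k; last first.
  rewrite (@extend0_out _ _ _ i j.+1) ?(@extend0_out _ _ _ i.+1 j.+1);
    by rewrite ?mul0r ?mulr0 // (ltnNge j.+1) jk andbF.
have := hminor (Ordinal (ltnW ik)) (Ordinal ik) (Ordinal (ltnW jk)) (Ordinal jk).
by rewrite -!extend0E /=; apply.
Qed.
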